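(* Let $d\ge2$ be an integer with prime factorisation $d=\prod_{i=1}^r p_i^{m_i}$ ($p_i$ distinct primes, $m_i\ge1$), and let $n\ge1$, $0\le k<n$. Then the number of $[[n,k]]_d$ stabilizer codes satisfies $$N(n,k,d)=\prod_{i=1}^r N(n,k,p_i^{m_i}),$$ and consequently $$N(n,k,d)=d^{\frac{(n-k)(n+3k+1)}{2}}\prod_{i=1}^r\zeta_i,\qquad \zeta_i:=\prod_{j=0}^{n-k-1}\frac{1-p_i^{-2(n-j)}}{1-p_i^{-(n-k-j)}}.$$
   Context: $N(n,k,q)$ denotes the number of $[[n,k]]_q$ stabilizer codes for qudits of dimension $q$ with configuration space $\mathbb{Z}_q$ (integers mod $q$). Definitions: $\Lambda=\begin{pmatrix}0&I_n\\-I_n&0\end{pmatrix}$; on $\mathbb{C}^q$ with basis $\{|j\rangle\}_{j\in\mathbb{Z}_q}$, $X|j\rangle=|j+1\rangle$, $Z|j\rangle=\omega^j|j\rangle$, $\omega=e^{2\pi i/q}$; the $n$-qudit Pauli group is generated by the $X_j,Z_j$ (and $e^{\pi i/q}I$ if $q$ even), each Pauli being a phase times $g(a)=X^{u_1}Z^{v_1}\otimes\cdots\otimes X^{u_n}Z^{v_n}$, $a=(u,v)\in\mathbb{Z}_q^{2n}$, with $g(a),g(b)$ commuting iff $a^T\Lambda b=0$. An $[[n,k]]_q$ stabilizer group is $S=\langle g_1,\dots,g_{n-k}\rangle$ of pairwise commuting Paulis each with eigenvalue $+1$ and $|S|=q^{n-k}$; its check matrix is $H=[a_1|\cdots|a_{n-k}]$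 with $g_j$ a phase times $g(a_j)$. Two stabilizer groups define the same stabilizer code iff their check matrices satisfy $H'=HA$ for some invertible $A$ over $\mathbb{Z}_q$; equivalently a code is the subgroup of $\mathbb{Z}_q^{2n}$ spanned by $n-k$ linearly independent (over $\mathbb{Z}_q$: $\sum x_ja_j=0\Rightarrow$ all $x_j=0$), pairwise symplectically orthogonal vectors. *)

(* Defs.v *)
From HB Require Import structures.
From mathcomp Require Import all_boot all_order all_algebra.
Set Implicit Arguments. Unset Strict Implicit. Unset Printing Implicit Defensive.
Import GRing.Theory.
Local Open Scope ring_scope.

(* Vectors a = (u,v) in Z_q^{2n} are row vectors of width n + n:
   the first n coordinates are u, the last n are v.  'Z_q is only a
   genuine Z/qZ for q >= 2 (it is used only with such q). *)

Definition Lambda (q n : nat) : 'M['Z_q]_(n + n) :=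
  block_mx 0 1%:M (- 1%:M) 0.

Definition sympl (q n : nat) (a b : 'rV['Z_q]_(n + n)) : 'Z_q :=
  (a *m Lambda q n *m b^T) 0 0.

Definition lin_indep (q n m : nat) (a : {ffun 'I_m -> 'rV['Z_q]_(n + n)}) : bool :=
  [forall x : {ffun 'I_m -> 'Z_q},
     (\sum_(j < m) x j *: a j == 0) ==> [forall j, x j == 0]].

Definition pairwise_orth (q n m : nat) (a : {ffun 'I_m -> 'rV['Z_q]_(n + n)}) : bool :=
  [forall i, forall j, sympl (a i) (a j) == 0].

Definition span_set (q n m : nat) (a : {ffun 'I_m -> 'rV['Z_q]_(n + n)})
  : {set 'rV['Z_q]_(n + n)} :=
  [set \sum_(j < m) x j *: a j | x : {ffun 'I_m -> 'Z_q}].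

Definition stab_codes (n k q : nat) : {set {set 'rV['Z_q]_(n + n)}} :=
  [set C | [exists a : {ffun 'I_(n - k) -> 'rV['Z_q]_(n + n)},
              [&& lin_indep a, pairwise_orth a & C == span_set a]]].

Definition N (n k q : nat) : nat := #|stab_codes n k q|.

(* Main.v *)
Require Import Defs.
From HB Require Import structures.
From mathcomp Require Import all_boot all_order all_algebra zify.
Set Implicit Arguments. Unset Strict Implicit. Unset Printing Implicit Defensive.
Import GRing.Theory Num.Theory.
Local Open Scope ring_scope.

(* The closed formula is proved directly for every modulus q >= 2; the product
   formula follows by comparing it with the formulas for the prime powers.
   Smith normal form over the integers shows that an independent family over
   Z_q is the beginning of a basis of the whole module.  In such a basis one
   reads off that an independent isotropic m-family in Z_q^l extends by one
   vector in exactly q^m * J(l - 2m) ways, where J(r) counts the unimodular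
   vectors of Z_q^r, and that an independent m-family extends to a longer
   independent one in q^m * J(l - m) ways.  Dividing the number of isotropic
   m-frames of Z_q^(2n) by the number of bases of Z_q^m gives
   N = prod_(j < m) J(2(n - j)) / J(m - j) with m = n - k, and a sieve over the
   primes dividing q evaluates J(r) = q^r * prod_(p | q) (1 - p^-r). *)

(** * Counting vectors over ['Z_q] by divisibility of their coordinates *)

Lemma card_Zp_dvdn (q e : nat) : (1 < q)%N -> (e %| q)%N ->
  #|[set x : 'Z_q | (e %| x)%N]| = (q %/ e)%N.
Proof.
move=> q_gt1 e_dvd.
rewrite cardsE -sum1_card big_mkcond /=.
rewrite -(big_mkord xpredT (fun i => if (e %| i)%N then 1%N else 0%N)).
rewrite Zp_cast // divn_count_dvd.
rewrite big_ltn ?(ltnW q_gt1) // dvdn0 [RHS]big_nat_recr ?(ltnW q_gt1) //= e_dvd addnC.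
by congr addn; apply: eq_bigr => i _; case: (_ %| _)%N.
Qed.

Lemma card_rV_dvdn (q e r : nat) : (1 < q)%N -> (e %| q)%N ->
  #|[set v : 'rV['Z_q]_r | [forall i, (e %| (v 0 i)%R)%N]]| = ((q %/ e) ^ r)%N.
Proof.
move=> q_gt1 e_dvd.
have bij : bijective (fun f : {ffun 'I_r -> 'Z_q} => \row_i f i).
  exists (fun v : 'rV_r => [ffun i => v 0 i]) => [f|v].
    by apply/ffunP => i; rewrite ffunE mxE.
  by apply/rowP => i; rewrite mxE ffunE.
rewrite -(on_card_preimset (onW_bij _ bij)) -(card_Zp_dvdn q_gt1 e_dvd).
rewrite -[r in RHS]card_ord -card_ffun_on; apply: eq_card => f.
by rewrite !inE; apply: eq_forallb => i; rewrite mxE inE.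
Qed.

(* The factor [e] makes the induction on [ps] go through: a vector divisible by
   [e] is either not divisible by [p], or divisible by [e * p]. *)
Lemma card_rV_sieve (q r : nat) (ps : seq nat) (e : nat) :
  (1 < q)%N -> all prime ps -> uniq ps -> all (coprime e) ps -> (0 < e)%N ->
  (e * \prod_(p <- ps) p %| q)%N ->
  #|[set v : 'rV['Z_q]_r | [forall i, (e %| (v 0 i)%R)%N] &&
       all (fun p => ~~ [forall i, (p %| (v 0 i)%R)%N]) ps]|%:R
  = (q%:R / e%:R) ^+ r * \prod_(p <- ps) (1 - (p%:R : rat) ^- r).
Proof.
move=> q_gt1; elim: ps e => [|p ps IHps] e /=.
  move=> _ _ _ e_gt0; rewrite !big_nil muln1 mulr1 => e_dvd.
  under eq_finset do rewrite andbT.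
  rewrite card_rV_dvdn // natrX; congr (_ ^+ _).
  rewrite -[in RHS](divnK e_dvd) natrM mulfK //.
  by rewrite pnatr_eq0 -lt0n.
case/andP=> p_pr ps_pr /andP[p_ps ps_uniq] /andP[co_ep co_eps] e_gt0.
rewrite !big_cons mulnA => ep_dvd.
have e_dvd : (e * \prod_(p <- ps) p %| q)%N.
  by apply: dvdn_trans ep_dvd; rewrite mulnAC dvdn_mulr.
have co_ps : all (coprime (e * p)%N) ps.
  apply/allP => p' p'_ps; rewrite coprimeMl (allP co_eps) //=.
  rewrite prime_coprime // dvdn_prime2 ?(allP ps_pr p') //.
  by apply: contraNneq p_ps => ->.
have ep_gt0 : (0 < e * p)%N by rewrite muln_gt0 e_gt0 prime_gt0.
have IHe := IHps e ps_pr ps_uniq co_eps e_gt0 e_dvd.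
have IHep := IHps (e * p)%N ps_pr ps_uniq co_ps ep_gt0 ep_dvd.
set A := [set v | _] in IHe; set B := [set v | _] in IHep.
set X := [set v | _].
(* [A] and [B] sieve by the remaining primes only, at levels [e] and [e * p]. As [e] and [p] are
   coprime, removing [B] from [A] removes exactly the vectors divisible by [p], whence the factor 1
   - p^-r. *)
have -> : X = A :\: B.
  apply/setP => v; rewrite !inE.
  have -> : [forall i, (e * p %| (v 0 i)%R)%N] =
      [forall i, (e %| (v 0 i)%R)%N] && [forall i, (p %| (v 0 i)%R)%N].
    apply/forallP/andP => [h|[/forallP h /forallP h'] i].
      by split; apply/forallP => i; have := h i; rewrite Gauss_dvd // => /andP[].
    by rewrite Gauss_dvd // h h'.
  by case: [forall i, (e %| _)%N]; case: [forall i, (p %| _)%N]; case: (all _ _).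
have sBA : B \subset A.
  apply/subsetP => v; rewrite !inE => /andP[/forallP h ->]; rewrite andbT.
  by apply/forallP => i; apply: dvdn_trans (h i); rewrite dvdn_mulr.
rewrite cardsD (setIidPr sBA) natrB ?subset_leq_card // IHe IHep natrM invfM.
rewrite mulrA exprMn exprVn -mulrBl mulrA; congr (_ * _).
by rewrite mulrBr mulr1 !exprMn !exprVn.
Qed.

(** * Independent rows and unimodular vectors *)

Definition mx_indep (q m l : nat) (H : 'M['Z_q]_(m, l)) : bool :=
  [forall x : 'rV_m, (x *m H == 0) ==> (x == 0)].

Lemma mx_indepP (q m l : nat) (H : 'M['Z_q]_(m, l)) :
  reflect (forall x : 'rV_m, x *m H = 0 -> x = 0) (mx_indep H).
Proof.
apply: (iffP forallP) => [h x xH | h x].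
  by apply/eqP; apply: (implyP (h x)); apply/eqP.
by apply/implyP => /eqP/h ->.
Qed.

Lemma Zp_mul_eq0 (q : nat) (x y : 'Z_q) : (1 < q)%N ->
  (x * y == 0) = (q %| x * y)%N.
Proof.
move=> q_gt1; rewrite -[x in LHS]natr_Zp -[y in LHS]natr_Zp -natrM -val_eqE.
by rewrite /= val_Zp_nat.
Qed.

(** A prime p of q dividing all coordinates makes q/p a nonzero annihilator of [v]; conversely, a
    nonzero annihilator x forces q/gcd(x,q) > 1 to divide every coordinate. *)
Lemma row_indepE (q r : nat) (v : 'rV['Z_q]_r) : (1 < q)%N ->
  mx_indep v = all (fun p => ~~ [forall i, (p %| (v 0 i)%R)%N]) (primes q).
Proof.
move=> q_gt1; have q_gt0 := ltnW q_gt1.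
have lt_q (x : 'Z_q) : (x < q)%N by rewrite -[ltnRHS]Zp_cast.
apply/mx_indepP/allP => [indep p | sieve x].
  rewrite mem_primes => /and3P[p_pr _ p_dvd].
  apply/negP => /forallP p_v.
  have /indep/rowP/(_ 0) : (q %/ p)%:R%:M *m v = 0.
    apply/rowP => i; rewrite mul_scalar_mx !mxE; apply/eqP.
    rewrite -[v 0 i]natr_Zp -natrM -val_eqE /= val_Zp_nat // -/(dvdn _ _).
    by rewrite -[X in (X %| _)%N](divnK p_dvd) dvdn_mul.
  (* The scalar q/p is not zero in ['Z_q], because 0 < q/p < q. *)
  rewrite !mxE mulr1n => /eqP; rewrite -val_eqE /= val_Zp_nat //.
  rewrite -/(dvdn _ _) => /dvdn_leq.
  rewrite divn_gt0 ?prime_gt0 // => /(_ (dvdn_leq q_gt0 p_dvd)).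
  by rewrite leqNgt ltn_Pdiv ?prime_gt1.
move=> xv; apply/rowP => j; rewrite ord1 mxE; apply/eqP/negPn/negP => x_neq0.
have x_gt0 : (0 < (x 0 0)%R)%N by rewrite lt0n.
set g := gcdn (x 0 0) q.
have g_gt0 : (0 < g)%N by rewrite gcdn_gt0 x_gt0.
have g_lt : (g < q)%N by apply: leq_ltn_trans (lt_q (x 0 0)); rewrite dvdn_leq ?dvdn_gcdl.
have qg_gt1 : (1 < q %/ g)%N by rewrite ltn_divRL ?dvdn_gcdr // mul1n.
have pr := pdiv_prime qg_gt1.
have /sieve/negP : pdiv (q %/ g) \in primes q.
  rewrite mem_primes pr q_gt0 (dvdn_trans (pdiv_dvd _)) //.
  by rewrite dvdn_div ?dvdn_gcdr.
apply; apply/forallP => i; apply: dvdn_trans (pdiv_dvd _) _.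
have : (q %| (x 0 0)%R * (v 0 i)%R)%N.
  by rewrite -Zp_mul_eq0 //; move/rowP/(_ i): xv; rewrite mxE big_ord1 mxE => ->.
(* Cancelling [g] leaves q/g dividing (x/g) v_i, and x/g is coprime to q/g. *)
rewrite -[X in (X %| _)%N](divnK (dvdn_gcdr (x 0 0) q)).
rewrite -[X in (_ %| X * _)%N](divnK (dvdn_gcdl (x 0 0) q)) mulnAC dvdn_pmul2r //.
rewrite Gauss_dvdr // coprime_sym /coprime -(eqn_pmul2r g_gt0) mul1n muln_gcdl.
by rewrite !divnK ?dvdn_gcdl ?dvdn_gcdr.
Qed.

(** Jordan's totient J_r(q), written J(r) in the overview. *)
Definition unimodular_count (q r : nat) : nat := #|[set v : 'rV['Z_q]_r | mx_indep v]|.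

Lemma prod_primes_logn (q : nat) : (0 < q)%N ->
  (\prod_(p <- primes q) p ^ logn p q)%N = q.
Proof.
by move=> q_gt0; rewrite [RHS]prod_prime_decomp // prime_decompE big_map.
Qed.

Lemma dvdn_prod_primes (q : nat) : (0 < q)%N -> (\prod_(p <- primes q) p %| q)%N.
Proof.
move=> q_gt0; rewrite -[X in (_ %| X)%N]prod_primes_logn //.
rewrite big_seq [X in (_ %| X)%N]big_seq.
apply: (big_ind2 (fun a b => a %| b)%N) => // [a1 a2 b1 b2|p p_q]; first exact: dvdn_mul.
by rewrite dvdn_exp ?logn_gt0.
Qed.

Lemma unimodular_countE (q r : nat) : (1 < q)%N ->
  (unimodular_count q r)%:R =
    q%:R ^+ r * \prod_(p <- primes q) (1 - (p%:R : rat) ^- r).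
Proof.
move=> q_gt1; rewrite -[q%:R in RHS]divr1 -(@card_rV_sieve q r (primes q) 1) //.
- congr (_%:R); apply: eq_card => v; rewrite !inE row_indepE //.
  by rewrite (_ : [forall i, _] = true) //; apply/forallP => i; rewrite dvd1n.
- by apply/allP => p; rewrite mem_primes => /andP[].
- exact: primes_uniq.
- by apply/allP => p _; rewrite coprime1n.
- by rewrite mul1n dvdn_prod_primes // ltnW.
Qed.

(** * Completing an independent family to a basis *)

(** Seen as a 1 by 1 matrix, a regular [x] is independent, so no prime of q divides it and it is
    coprime to q. *)
Lemma Zp_regular_unit (q : nat) (x : 'Z_q) : (1 < q)%N ->
  (forall y, y * x = 0 -> y = 0) -> x \is a GRing.unit.
Proof.
move=> q_gt1 reg; rewrite -[x]natr_Zp unitZpE //.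
have : mx_indep (x%:M : 'M_1).
  apply/mx_indepP => y; rewrite mul_mx_scalar => /rowP/(_ 0); rewrite !mxE mulrC.
  by move=> /reg y0; apply/rowP => i; rewrite ord1 mxE.
rewrite row_indepE // => /allP sieve.
rewrite coprime_has_primes ?(ltnW q_gt1) //.
  apply/hasPn => p; rewrite mem_primes => /and3P[p_pr _ p_x].
  apply/negP => /sieve/negP; apply; apply/forallP => i.
  by rewrite ord1 mxE mulr1n.
rewrite lt0n; apply/eqP => val_x0; have x0 : x = 0 by apply: val_inj.
have := reg 1; rewrite mul1r x0 => /(_ erefl)/eqP.
by rewrite oner_eq0.
Qed.

Lemma mx_indep_mulr (q m l : nat) (H : 'M['Z_q]_(m, l)) (V : 'M_l) :
  V \in unitmx -> mx_indep (H *m V) = mx_indep H.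
Proof.
move=> V_unit; apply/mx_indepP/mx_indepP => indep x; rewrite ?mulmxA.
  by move=> xH; apply: indep; rewrite mulmxA xH mul0mx.
by move=> /(congr1 (mulmx^~ (invmx V))); rewrite mulmxK // mul0mx => /indep.
Qed.

(** Lifting [H] to the integers and reducing its Smith form mod q gives H = L D [1 0] P with L and P
    invertible. Independence makes the diagonal of D regular, hence invertible, and the rows [0 1] P
    complete the basis. *)
Lemma mx_indep_complete (q m r : nat) (H : 'M['Z_q]_(m, m + r)) : (1 < q)%N ->
  mx_indep H -> exists K : 'M_(r, m + r), col_mx H K \in unitmx.
Proof.
move=> q_gt1 indepH.
have [L L_unit [P P_unit [d _ HE]]] :=
  int_Smith_normal_form (map_mx (fun x : 'Z_q => (x : nat)%:Z) H).
pose f : {rmorphism int -> 'Z_q} := intr.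
have fH : map_mx f (map_mx (fun x : 'Z_q => (x : nat)%:Z) H) = H.
  by apply/matrixP => i j; rewrite !mxE /= -pmulrn natr_Zp.
have f_unit l (A : 'M[int]_l) : A \in unitmx -> map_mx f A \in unitmx.
  by rewrite !unitmxE det_map_mx; apply: rmorph_unit.
(* Entries beyond the end of [d] default to 0; the regularity shown for [D_unit] excludes them. *)
pose D := diag_mx (\row_(i < m) f d`_i).
have {fH HE} HE : H = map_mx f L *m (D *m row_mx 1%:M 0) *m map_mx f P.
  rewrite -[LHS]fH HE !map_mxM /=; congr (_ *m _ *m _).
  apply/matrixP => i j; rewrite mul_mx_row mulmx1 mulmx0 !mxE.
  case: splitP => k jk; rewrite !mxE jk rmorphMn /=.
    by [].
  by rewrite ltn_eqF //= ltn_addr.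
have D_unit : D \in unitmx.
  rewrite unitmxE det_diag; apply: rpred_prod => i _; rewrite mxE.
  apply: Zp_regular_unit => // y yd.
  (* The test vector y e_i L^-1 is sent by [H] to y d_i times row i of [1 0] P, which vanishes. *)
  have /mx_indepP/(_ (y *: delta_mx 0 i *m invmx (map_mx f L))) := indepH.
  rewrite {1}HE !mulmxA mulmxKV ?f_unit // -scalemxAl -rowE row_diag_mx mxE.
  rewrite scalerA yd scale0r !mul0mx => /(_ erefl).
  move/(congr1 (mulmx^~ (map_mx f L))); rewrite mulmxKV ?f_unit // mul0mx.
  by move/rowP/(_ i); rewrite !mxE !eqxx mulr1.
exists (row_mx 0 1%:M *m map_mx f P) => //.
have -> : col_mx H (row_mx 0 1%:M *m map_mx f P) =
    block_mx (map_mx f L *m D) 0 0 1%:M *m map_mx f P.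
  by rewrite HE -mul_col_mx mulmxA mul_mx_row mulmx1 mulmx0.
rewrite unitmx_mul f_unit // andbT unitmxE det_ublock det1 mulr1 -unitmxE.
by rewrite unitmx_mul f_unit.
Qed.

(** * Extending a family by one vector *)

(** Subtracting [c] times the lower rows clears [c]: modulo the span of the old vectors, only [w]
    matters. *)
Lemma mx_indep_col_row1 (q m r : nat) (c : 'rV['Z_q]_m) (w : 'rV['Z_q]_r) :
  mx_indep (col_mx (row_mx c w) (row_mx 1%:M 0)) = mx_indep w.
Proof.
apply/mx_indepP/mx_indepP => indep x.
  move=> xw; have := indep (row_mx x (- (x *m c))).
  rewrite mul_row_col !mul_mx_row mulmx1 mulmx0 xw add_row_mx subrr add0r row_mx0.
  by move=> /(_ erefl)/(congr1 lsubmx); rewrite row_mxKl linear0.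
rewrite -[x]hsubmxK mul_row_col !mul_mx_row mulmx1 mulmx0 add_row_mx addr0 -row_mx0.
case/eq_row_mx => + /indep x0; rewrite x0 mul0mx add0r => ->.
by rewrite !row_mx0.
Qed.

Lemma mx_indep_row0 (q m r : nat) (w : 'rV['Z_q]_r) :
  mx_indep (row_mx (0 : 'rV_m) w) = mx_indep w.
Proof.
apply/mx_indepP/mx_indepP => indep x; rewrite ?mul_mx_row ?mulmx0.
  by move=> xw; apply: indep; rewrite mul_mx_row mulmx0 xw row_mx0.
by rewrite -row_mx0 => /eq_row_mx[_ /indep].
Qed.

Lemma bij_mulmx (q l : nat) (V : 'M['Z_q]_l) :
  V \in unitmx -> bijective (fun b : 'rV_l => b *m V).
Proof. by move=> V_unit; exists (mulmx^~ (invmx V)) => b; rewrite ?mulmxK ?mulmxKV. Qed.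

Lemma bij_row_mx (T : Type) (m r : nat) :
  bijective (fun p : 'rV[T]_m * 'rV[T]_r => row_mx p.1 p.2).
Proof.
by exists (fun b => (lsubmx b, rsubmx b)) => [[c w]|b];
  rewrite ?row_mxKl ?row_mxKr ?hsubmxK.
Qed.

Lemma card_rV_Zp (q m : nat) : (1 < q)%N -> #|{: 'rV['Z_q]_m}| = (q ^ m)%N.
Proof. by move=> q_gt1; rewrite card_mx mul1n card_ord Zp_cast. Qed.

(** Writing b = c H + w K, the part [c] is free and contributes q^m, while independence concerns [w]
    alone. [P] carries a further condition that also sees only [w]. *)
Lemma card_extend_indep (q m r : nat) (H : 'M['Z_q]_(m, m + r)) (K : 'M_(r, m + r))
    (P : pred 'rV['Z_q]_(m + r)) (Q : pred 'rV['Z_q]_r) :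
  (1 < q)%N -> col_mx H K \in unitmx ->
  (forall c w, P (row_mx c w *m col_mx H K) = Q w) ->
  #|[set b | mx_indep (col_mx b H) && P b]| =
    (q ^ m * #|[set w | mx_indep w && Q w]|)%N.
Proof.
move=> q_gt1 V_unit PQ.
rewrite -(on_card_preimset (onW_bij _ (bij_mulmx V_unit))).
rewrite -(on_card_preimset (onW_bij _ (@bij_row_mx 'Z_q m r))).
rewrite -(card_rV_Zp m q_gt1) -cardsT -cardsX; apply: eq_card => -[c w].
rewrite !inE PQ /= -(mx_indep_col_row1 c w) -[in RHS](mx_indep_mulr _ V_unit).
by rewrite mul_col_mx !mul_row_col mul1mx mul0mx addr0.
Qed.

Lemma card_extend_frame (q m r : nat) (H : 'M['Z_q]_(m, m + r)) :
  (1 < q)%N -> mx_indep H ->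
  #|[set b : 'rV_(m + r) | mx_indep (col_mx b H)]| = (q ^ m * unimodular_count q r)%N.
Proof.
move=> q_gt1 /(mx_indep_complete q_gt1)[K V_unit].
have := card_extend_indep (P := predT) (Q := predT) q_gt1 V_unit (fun _ _ => erefl).
by under eq_finset do rewrite andbT; under [in RHS]eq_finset do rewrite andbT.
Qed.

(** In coordinates given by the inverse transpose of a basis completing [M], multiplying by [M^T]
    reads off the first m coordinates. These must vanish, and the other s form a unimodular
    vector. *)
Lemma card_orth_unimodular (q m s : nat) (M : 'M['Z_q]_(m, m + s)) :
  (1 < q)%N -> mx_indep M ->
  #|[set w : 'rV_(m + s) | mx_indep w && (w *m M^T == 0)]| = unimodular_count q s.
Proof.
move=> q_gt1 /(mx_indep_complete q_gt1)[K W_unit].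
have WT_unit : (col_mx M K)^T \in unitmx by rewrite unitmx_tr.
have WTV_unit : invmx (col_mx M K)^T \in unitmx by rewrite unitmx_inv.
rewrite -(on_card_preimset (onW_bij _ (bij_mulmx WTV_unit))).
rewrite -[RHS](card_imset _ (can_inj (@row_mxKr _ 1 m s 0))); apply: eq_card => w.
rewrite !inE mx_indep_mulr //.
have -> : w *m invmx (col_mx M K)^T *m M^T = lsubmx w.
  by rewrite -[M in _ *m M^T](col_mxKu M K) trmx_usub mulmx_lsub mulmxKV.
apply/andP/imsetP => [[indep /eqP w0]|[z + ->]].
  exists (rsubmx w); last by rewrite -w0 hsubmxK.
  by rewrite inE -(mx_indep_row0 m) -w0 hsubmxK.
by rewrite inE row_mxKl mx_indep_row0 eqxx.
Qed.

(** For b = c H + w K, isotropy of [H] removes [c] from the orthogonality condition, which becomes w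
    M^T = 0 with M = H L K^T. *)
Lemma card_extend_isotropic (q m s : nat) (L : 'M['Z_q]_(m + (m + s)))
    (H : 'M['Z_q]_(m, m + (m + s))) :
  (1 < q)%N -> L \in unitmx -> mx_indep H -> H *m L *m H^T = 0 ->
  #|[set b : 'rV_(m + (m + s)) | mx_indep (col_mx b H) && (b *m (H *m L)^T == 0)]| =
    (q ^ m * unimodular_count q s)%N.
Proof.
move=> q_gt1 L_unit indepH isoH.
have [K V_unit] := mx_indep_complete q_gt1 indepH.
pose M := H *m L *m K^T.
have indepM : mx_indep M.
  apply/mx_indepP => x xM; have /mx_indepP := indepH; apply.
  (* With V = [H; K], H L V^T = [0 M]; so x M = 0 gives x H L V^T = 0, and V^T and L can be
     cancelled. *)
  have : x *m (H *m L *m (col_mx H K)^T) = 0.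
    by rewrite tr_col_mx mul_mx_row isoH mul_mx_row mulmx0 xM row_mx0.
  have V_unitT : (col_mx H K)^T \in unitmx by rewrite unitmx_tr.
  rewrite !mulmxA => /(congr1 (mulmx^~ (invmx (col_mx H K)^T))).
  rewrite mulmxK // mul0mx => /(congr1 (mulmx^~ (invmx L))).
  by rewrite mulmxK // mul0mx.
rewrite (card_extend_indep (Q := fun w => w *m M^T == 0) q_gt1 V_unit).
  by rewrite card_orth_unimodular.
move=> c w /=.
have HHL : H *m (H *m L)^T = 0.
  by move/(congr1 trmx): isoH; rewrite trmx_mul trmxK trmx0.
by rewrite mul_row_col mulmxDl -!mulmxA HHL mulmx0 add0r /M (trmx_mul (H *m L)) trmxK.
Qed.

(** * Counting independent and isotropic frames *)

(** Sorting matrices by their lower m rows gives fibres of constant size [c]; this is the induction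
    step of both frame counts. *)
Lemma card_col_mx (q m l c : nat) (P1 : pred 'M['Z_q]_(1 + m, l))
    (P0 : pred 'M['Z_q]_(m, l)) :
  (forall b H, P1 (col_mx b H) -> P0 H) ->
  (forall H, P0 H -> #|[set b | P1 (col_mx b H)]| = c) ->
  #|[set X | P1 X]| = (#|[set H | P0 H]| * c)%N.
Proof.
move=> P10 fibre.
rewrite -sum1_card (partition_big dsubmx P0) => [|X]; last first.
  by rewrite inE -{1}[X]vsubmxK => /P10.
rewrite cardsE -sum_nat_const; apply: eq_bigr => H /fibre <-.
rewrite sum1dep_card -(card_imset _ (can_inj (@col_mxKu _ 1 m l ^~ H))).
apply: eq_card => X; rewrite !inE; apply/andP/imsetP => [[PX /eqP <-]|[b + ->]].
  by exists (usubmx X); rewrite ?inE vsubmxK.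
by rewrite inE col_mxKd.
Qed.

Lemma mx_indep_dsub (q m l : nat) (b : 'rV['Z_q]_l) (H : 'M_(m, l)) :
  mx_indep (col_mx b H) -> mx_indep H.
Proof.
move=> /mx_indepP indep; apply/mx_indepP => x xH.
have := indep (row_mx 0 x); rewrite mul_row_col mul0mx add0r => /(_ xH).
by move/(congr1 rsubmx); rewrite row_mxKr linear0.
Qed.

Lemma card_frames (q m l : nat) : (1 < q)%N -> (m <= l)%N ->
  #|[set H : 'M['Z_q]_(m, l) | mx_indep H]| =
    (\prod_(j < m) (q ^ j * unimodular_count q (l - j)))%N.
Proof.
move=> q_gt1; elim: m => [|m IHm] m_l.
  rewrite big_ord0 (_ : [set _ | _] = setT); last first.
    by apply/setP => H; rewrite !inE; apply/mx_indepP => x _; apply: thinmx0.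
  by rewrite cardsT card_mx mul0n.
rewrite big_ord_recr /= -IHm ?(ltnW m_l) //; apply: card_col_mx => [b H|].
  exact: mx_indep_dsub.
have [r ->] : exists r, l = (m + r)%N by exists (l - m)%N; rewrite subnKC // ltnW.
by rewrite addKn => H indepH; apply: card_extend_frame.
Qed.

Definition isotropic_frames (q m l : nat) (L : 'M['Z_q]_l) : {set 'M['Z_q]_(m, l)} :=
  [set H | mx_indep H && (H *m L *m H^T == 0)].

Lemma card_isotropic_frames (q m l : nat) (L : 'M['Z_q]_l) :
  (1 < q)%N -> L \in unitmx -> L^T = - L -> (forall a : 'rV_l, a *m L *m a^T = 0) ->
  (2 * m <= l)%N ->
  #|isotropic_frames m L| =
    (\prod_(j < m) (q ^ j * unimodular_count q (l - 2 * j)))%N.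
Proof.
move=> q_gt1 L_unit L_skew L_alt; elim: m => [|m IHm] m_l.
  rewrite big_ord0 (_ : isotropic_frames _ _ = setT); last first.
    apply/setP => H; rewrite !inE [H]flatmx0 !mul0mx eqxx andbT.
    by apply/mx_indepP => x _; apply: thinmx0.
  by rewrite cardsT card_mx mul0n.
have m_l' : (2 * m <= l)%N by apply: leq_trans m_l; rewrite leq_mul2l leqnSn.
rewrite big_ord_recr /= -IHm //.
(* The corner b L b^T vanishes as [L] is alternating, and by skewness the two off-diagonal blocks
   agree up to sign and transposition, so one orthogonality condition on [b] remains. *)
have isoE (b : 'rV_l) (H : 'M_(m, l)) :
    (col_mx b H *m L *m (col_mx b H)^T == 0) =
    (b *m (H *m L)^T == 0) && (H *m L *m H^T == 0).
  have bH : b *m (H *m L)^T = - (b *m L *m H^T).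
    by rewrite trmx_mul L_skew mulNmx mulmxN mulmxA.
  rewrite mul_col_mx tr_col_mx mul_col_row L_alt bH.
  have -> : H *m L *m b^T = (b *m (H *m L)^T)^T.
    by rewrite [RHS]trmx_mul trmxK.
  rewrite bH linearN /= oppr_eq0.
  apply/eqP/andP => [|[/eqP-> /eqP->]].
    by rewrite -block_mx0 => /eq_block_mx[_ -> _ ->].
  by rewrite trmx0 oppr0 block_mx0.
apply: card_col_mx => [b H|H /andP[indepH /eqP isoH]] /=.
  by rewrite isoE => /and3P[/mx_indep_dsub-> _ ->].
have [s El] : exists s, l = (m + (m + s))%N.
  by exists (l - 2 * m)%N; rewrite addnA addnn -mul2n subnKC.
subst l; have -> : (m + (m + s) - 2 * m = s)%N by rewrite addnA addnn -mul2n addKn.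
rewrite -(card_extend_isotropic q_gt1 L_unit indepH isoH).
by apply: eq_card => b; rewrite !inE isoE isoH eqxx andbT.
Qed.

(** * From frames to their spans *)

Definition mx_span (q m l : nat) (A : 'M['Z_q]_(m, l)) : {set 'rV['Z_q]_l} :=
  [set x *m A | x : 'rV_m].

(** The frames with the same span as [A] are the products [X *m A] with [X] square and independent,
    and [X] is determined by the product; so all fibres of [mx_span] have the same size. *)
Lemma card_frames_span (q m l : nat) (L : 'M['Z_q]_l) :
  #|isotropic_frames m L| =
  (#|[set mx_span A | A in isotropic_frames m L]| *
   #|[set X : 'M['Z_q]_m | mx_indep X]|)%N.
Proof.
rewrite -sum1_card (partition_big_imset (@mx_span q m l)) /= -sum_nat_const.
apply: eq_bigr => _ /imsetP[A A_frame ->].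
have := A_frame; rewrite inE => /andP[/mx_indepP indepA /eqP isoA].
have inj_mulA : injective (fun X : 'M_m => X *m A).
  move=> X Y /= XA; apply/row_matrixP => i; apply/subr0_eq/indepA.
  by rewrite mulmxBl -!row_mul XA subrr.
rewrite sum1dep_card -(card_imset _ inj_mulA); apply: eq_card => B.
rewrite !inE; apply/andP/imsetP => [[/andP[indepB isoB] /eqP spanB]|[X + ->]].
  have row_B i : exists x : 'rV_m, row i B == x *m A.
    have : row i B \in mx_span A by rewrite -spanB rowE; apply/imsetP; exists (delta_mx 0 i).
    by case/imsetP => x _ ->; exists x.
  pose X := \matrix_i xchoose (row_B i).
  have BE : B = X *m A.
    by apply/row_matrixP => i; rewrite row_mul rowK; apply/eqP/(xchooseP (row_B i)).
  exists X => //; rewrite inE; apply/mx_indepP => x xX.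
  by have /mx_indepP := indepB; apply; rewrite BE mulmxA xX mul0mx.
rewrite inE => /mx_indepP indepX; split.
  rewrite -!mulmxA trmx_mul !mulmxA -!(mulmxA X) isoA mul0mx mulmx0 eqxx andbT.
  by apply/mx_indepP => x; rewrite mulmxA => /indepA/indepX.
(* An injective self-map of a finite set is onto, so passing from [A] to [X *m A] does not shrink
   the span. *)
have injX : injective (fun x : 'rV_m => x *m X).
  by move=> x y /= xX; apply/subr0_eq/indepX; rewrite mulmxBl xX subrr.
have [Y XK YK] := injF_bij injX.
apply/eqP/setP => v; apply/imsetP/imsetP => -[x _ ->].
  by exists (x *m X); rewrite ?mulmxA.
by exists (Y x) => //; rewrite mulmxA YK.
Qed.

(** * The symplectic form and stabilizer codes *)

Lemma Lambda_skew (q n : nat) : (Lambda q n)^T = - Lambda q n.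
Proof. by rewrite tr_block_mx opp_block_mx !linearN /= !trmx1 !trmx0 oppr0 opprK. Qed.

Lemma Lambda_unit (q n : nat) : Lambda q n \in unitmx.
Proof.
have : Lambda q n *m (- Lambda q n) = 1%:M.
  rewrite mulmxN mulmx_block !mulmx0 !mul0mx !mulmx1 !mul1mx !addr0 !add0r.
  by rewrite opp_block_mx opprK oppr0 -scalar_mx_block.
by case/mulmx1_unit.
Qed.

Lemma Lambda_alt (q n : nat) (a : 'rV['Z_q]_(n + n)) : a *m Lambda q n *m a^T = 0.
Proof.
rewrite -[a]hsubmxK; set u := lsubmx a; set v := rsubmx a.
rewrite mul_row_block !mulmx0 mulmx1 mulmxN mulmx1 add0r addr0 tr_row_mx mul_row_col.
(* What remains is - v u^T + u v^T; a 1 by 1 matrix equals its transpose, so the terms cancel. *)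
rewrite mulNmx -[u *m _]trmxK trmx_mul trmxK.
rewrite [v *m u^T]mx11_scalar tr_scalar_mx; exact: addNr.
Qed.

Lemma stab_codesE (n k q : nat) :
  stab_codes n k q = [set mx_span A | A in isotropic_frames (n - k) (Lambda q n)].
Proof.
pose mx (a : {ffun 'I_(n - k) -> 'rV['Z_q]_(n + n)}) := \matrix_j a j.
have mulE x a : x *m mx a = \sum_j x 0 j *: a j.
  by rewrite mulmx_sum_row; apply: eq_bigr => j _; rewrite rowK.
have sumE (x : {ffun 'I_(n - k) -> 'Z_q}) (a : {ffun 'I_(n - k) -> 'rV_(n + n)}) :
    \sum_j x j *: a j = (\row_j x j) *m mx a.
  by rewrite mulE; apply: eq_bigr => j _; rewrite mxE.
have indepE a : lin_indep a = mx_indep (mx a).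
  apply/forallP/mx_indepP => [h x xa | h x].
    have := h [ffun j => x 0 j]; rewrite sumE.
    have -> : \row_j [ffun j => x 0 j] j = x by apply/rowP => j; rewrite mxE ffunE.
    rewrite xa eqxx /= => /forallP x0; apply/rowP => j.
    by have := x0 j; rewrite ffunE mxE => /eqP.
  apply/implyP; rewrite sumE => /eqP/h/rowP x0; apply/forallP => j.
  by have := x0 j; rewrite !mxE => ->.
have orthE a : pairwise_orth a = (mx a *m Lambda q n *m (mx a)^T == 0).
  have entry i j : (mx a *m Lambda q n *m (mx a)^T) i j = sympl (a i) (a j).
    rewrite /sympl -[a i](rowK a) -[a j](rowK a) -/(mx a) -row_mul tr_row.
    by rewrite !mxE; apply: eq_bigr => l _; rewrite !mxE.
  apply/forallP/eqP => [h | h i].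
    by apply/matrixP => i j; rewrite entry mxE; apply/eqP/(forallP (h i)).
  by apply/forallP => j; rewrite -entry h mxE.
have spanE a : span_set a = mx_span (mx a).
  apply/setP => v; apply/imsetP/imsetP => -[x _ ->].
    by exists (\row_j x j); rewrite ?sumE.
  exists [ffun j => x 0 j] => //; rewrite mulE.
  by apply: eq_bigr => j _; rewrite ffunE.
apply/setP => S; rewrite inE; apply/existsP/imsetP.
  case=> a /and3P[indep orth /eqP->]; exists (mx a); last by rewrite spanE.
  by rewrite inE -indepE indep -orthE.
case=> A; rewrite inE => /andP[indep orth] ->; exists [ffun j => row j A].
have mxA : mx [ffun j => row j A] = A.
  by apply/row_matrixP => i; rewrite rowK ffunE.
by rewrite indepE orthE spanE mxA indep orth eqxx.
Qed.

(** Comparing isotropic frames with their spans, the powers q^j occur on both sides and cancel. The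
    product form avoids division of natural numbers. *)
Lemma N_mul_frames (n k q : nat) : (1 < q)%N ->
  (N n k q * \prod_(j < n - k) unimodular_count q (n - k - j) =
   \prod_(j < n - k) unimodular_count q (2 * (n - j)))%N.
Proof.
move=> q_gt1; have m_n : (2 * (n - k) <= n + n)%N.
  by rewrite addnn -mul2n leq_mul2l leq_subr orbT.
have := card_frames_span (n - k) (Lambda q n).
rewrite -stab_codesE card_frames // card_isotropic_frames //; first last.
- exact: Lambda_alt.
- exact: Lambda_skew.
- exact: Lambda_unit.
rewrite !big_split /= mulnCA => /eqP; rewrite eqn_pmul2l.
  by move/eqP <-; apply: eq_bigr => j _; rewrite mulnBr addnn -mul2n.
by rewrite prodn_gt0 // => j; rewrite expn_gt0 ltnW.
Qed.

(** * Exponent arithmetic and the closed formula *)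

Lemma sum_code_exponent (m k : nat) :
  (m * (m + k + 3 * k + 1) %/ 2 + \sum_(j < m) (m - j) =
   \sum_(j < m) 2 * (m + k - j))%N.
Proof.
(* The bound m <= c keeps c - j from truncating, and m * m stands on the left to avoid another
   subtraction. It is used for c = m and c = m + k. *)
have sumB c : (m <= c)%N ->
    (2 * \sum_(j < m) (c - j) + m * m = m * (2 * c + 1))%N.
  elim: m => [|m IHm] m_c; first by rewrite big_ord0.
  rewrite big_ord_recr /=; have := IHm (ltnW m_c); set S := (\sum_(_ < _) _)%N.
  have [r ->] : exists r, c = (m + r)%N by exists (c - m)%N; rewrite subnKC // ltnW.
  rewrite addKn. nia.
have := sumB m (leqnn m); have := sumB (m + k)%N (leq_addr k m).
rewrite -big_distrr /=.
have -> : (m * (m + k + 3 * k + 1) = 2 * k * m * 2 + m * (m + 1))%N by nia.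
rewrite divnMDl //.
set S := (\sum_(j < m) (m - j))%N; set T := (\sum_(j < m) _)%N => hT hS.
have -> : (m * (m + 1) = S * 2)%N by nia.
by rewrite mulnK //; nia.
Qed.

Lemma N_closed_form (n k q : nat) : (1 < q)%N -> (k < n)%N ->
  (N n k q)%:R =
    (q%:R : rat) ^+ (((n - k) * (n + 3 * k + 1)) %/ 2) *
    \prod_(p <- primes q)
       \prod_(j < n - k)
         ((1 - (p%:R : rat) ^- (2 * (n - j))) / (1 - (p%:R : rat) ^- (n - k - j))).
Proof.
move=> q_gt1 k_n; set m := (n - k)%N.
have nE : n = (m + k)%N by rewrite subnK // ltnW.
have q_neq0 : (q%:R : rat) != 0 by rewrite pnatr_eq0 -lt0n ltnW.
(* Since j < m, the exponent m - j is positive and p^(m - j) differs from 1. *)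
have den_neq0 p j : p \in primes q -> (j < m)%N -> 1 - (p%:R : rat) ^- (m - j) != 0.
  rewrite mem_primes => /and3P[/prime_gt1 p_gt1 _ _] j_m.
  rewrite subr_eq0 eq_sym invr_eq1 pexpr_eq1 ?ler0n ?subn_gt0 //.
  by rewrite pnatr_eq1 neq_ltn p_gt1 orbT.
have /(congr1 (fun x => x%:R : rat)) := N_mul_frames n k q_gt1.
rewrite natrM !natr_prod -/m.
under eq_bigr do rewrite unimodular_countE //.
under [in RHS]eq_bigr do rewrite unimodular_countE //.
rewrite !big_split /= !prodrXr exchange_big [in RHS]exchange_big /=.
(* The exponent of q on the isotropic side splits as [E + S], where [S] is its exponent in the count
   of bases; q^S then cancels. *)
rewrite {2}nE -sum_code_exponent -nE exprD.
set S := (\sum_(j < m) (m - j))%N; set E := (_ %/ 2)%N.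
set den := \prod_(p <- _) _; set num := \prod_(p <- _) _ => NE.
have dnz : den != 0.
  rewrite /den big_seq prodf_seq_neq0; apply/allP => p p_q; rewrite p_q /=.
  by apply/prodf_neq0 => j _; rewrite den_neq0.
have qS_neq0 : (q%:R : rat) ^+ S != 0 by rewrite expf_neq0.
under eq_bigr do rewrite big_split /= prodfV.
rewrite big_split /= prodfV -/den -/num.
apply: (mulIf (mulf_neq0 qS_neq0 dnz)); rewrite NE mulrACA; congr (_ * _).
by rewrite divfK.
Qed.

(** * Factorisation over the prime powers of the modulus *)

Unset Implicit Arguments.

Theorem theorem2 (d n k : nat) (hd : (2 <= d)%N) (hn : (1 <= n)%N) (hk : (k < n)%N) :
  N n k d = (\prod_(p <- primes d) N n k (p ^ logn p d))%N /\
  (N n k d)%:R =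
    (d%:R : rat) ^+ (((n - k) * (n + 3 * k + 1)) %/ 2) *
    \prod_(p <- primes d)
       \prod_(j < n - k)
         ((1 - (p%:R : rat) ^- (2 * (n - j))) / (1 - (p%:R : rat) ^- (n - k - j))).
Proof.
split; last exact: N_closed_form.
apply/eqP; rewrite -(eqr_nat rat) natr_prod N_closed_form //; apply/eqP.
(* Splitting the base d into its prime powers turns both sides into products over [primes d],
   compared factor by factor. *)
rewrite -[X in X%:R ^+ _](prod_primes_logn (ltnW hd)) natr_prod -prodrXl -big_split /=.
apply: eq_big_seq => p; rewrite -logn_gt0 => logp_gt0.
have p_pr : prime p by move: logp_gt0; rewrite logn_gt0 mem_primes => /andP[].
rewrite N_closed_form //; last first.
  by rewrite (leq_trans (prime_gt1 p_pr)) // -{1}[p]expn1 leq_exp2l ?prime_gt1.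
by rewrite primesX // primes_prime // big_seq1.
Qed.
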